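(* Let $H$ be a stable $n$-th order LTI model in diagonal canonical form $H(s)=D+\sum_{i=1}^n\frac{\Phi_i}{s-\lambda_i}$, let $0<r<n$ and $0<\omega<\infty$. For $\alpha\in\{0,1\}^n$ and $D_\alpha\in\mathbb{R}^{n_y\times n_u}$ let $H_\alpha(s)=D_\alpha+\sum_{i=1}^n\alpha_i\frac{\Phi_i}{s-\lambda_i}$. Set $\bar\alpha=\mathbf{1}-\alpha\in\mathbb{R}^n$, $m=n+n_yn_u$, $d=\mathrm{vec}(D)\in\mathbb{R}^{n_yn_u}$, $d_\alpha=\mathrm{vec}(D_\alpha)\in\mathbb{R}^{n_yn_u}$, $a_\omega(\lambda_i)=\mathrm{atan}(\frac{\omega}{\lambda_i})$ and $x_\alpha=[\bar\alpha^T,d_\alpha^T]^T\in\mathbb{R}^m$. Then the $r$-th order optimal $\mathcal{H}_{2,\omega}$ modal truncation model $H_\alpha^\star$, i.e. the solution of $$\min_{\alpha,D_\alpha}\ \Vert H-H_\alpha\Vert_{2,\omega}\quad\text{s.t.}\quad\alpha\in\{0,1\}^n,\ D_\alpha\in\mathbb{R}^{n_y\times n_u},\ \mathbf{1}^T\alpha=r,\ M\alpha=0,$$ is obtained through $x_\alpha^\star$, solution of the following strictly convex mixed quadratic problem: $$\min_{\alpha,d_\alpha}\ x_\alpha^T\mathcal{Q}_\omega x_\alpha+c_\omega^Tx_\alpha\quad\text{s.t.}\quad\alpha\in\{0,1\}^n,\ d_\alpha\in\mathbb{R}^{n_yn_u},\ \mathbf{1}^T\alpha=r,\ M\alpha=0,$$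 where $\mathcal{Q}_\omega\in\mathbb{C}^{m\times m}$ is a Hermitian matrix defined as $$\mathcal{Q}_\omega=\begin{bmatrix}Q_\omega&\frac12U_\omega\\ \frac12U_\omega^H&\frac{\omega}{\pi}I_{n_yn_u}\end{bmatrix},$$ where the top left block is given, for $i,j=1,\ldots,n$, by $$[Q_\omega]_{i,j}=-\frac1\pi\left(a_\omega(\lambda_i)+a_\omega(\lambda_j^* )\right)[Q]_{i,j},\qquad [Q]_{i,j}=\frac{\mathrm{tr}(\Phi_i\Phi_j^H)}{-\lambda_i-\lambda_j^*},$$ the off-diagonal term is given, for $i=1,\ldots,n$, by $$e_i^TU_\omega=-\frac2\pi a_\omega(\lambda_i)\,\mathrm{vec}(\Phi_i)^T,$$ and the linear term is given by $$c_\omega=-\frac2\pi\begin{bmatrix}a_\omega(\lambda_1)\mathrm{vec}(\Phi_1)^Td&\cdots&a_\omega(\lambda_n)\mathrm{vec}(\Phi_n)^Td&\omega d^T\end{bmatrix}^T.$$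
   Context: Setting. $H$ is the LTI model $\dot x=Ax+Bu$, $y=Cx+Du$ with real matrices $A\in\mathbb{R}^{n\times n}$, $B\in\mathbb{R}^{n\times n_u}$, $C\in\mathbb{R}^{n_y\times n}$, $D\in\mathbb{R}^{n_y\times n_u}$, identified with its transfer function $H(s)=C(sI-A)^{-1}B+D$. It is stable (all eigenvalues of $A$ lie in the open left half-plane) and $A$ has semi-simple eigenvalues $\lambda_1,\dots,\lambda_n$. With $AX=X\Delta$, $\Delta=\mathrm{diag}(\lambda_1,\dots,\lambda_n)$, $X$ the invertible matrix of right eigenvectors, $B_\Delta=X^{-1}B$, $C_\Delta=CX$, the residues are $\Phi_i=C_\Delta e_ie_i^TB_\Delta\in\mathbb{C}^{n_y\times n_u}$, which gives the diagonal canonical form. Conjugate pairs. Each non-real pole-residue pair comes with its complex conjugate; there are $n_c$ such conjugate pairs of indices $\{i,j\}$, with $\mathrm{Im}(\lambda_i)>0$ and $\lambda_j=\lambda_i^*$. $M\in\mathbb{R}^{n_c\times n}$ has one row per pair $\{i,j\}$, with entry $1$ in column $i$, $-1$ in column $j$ and $0$ elsewhere; thus $M\alpha=0$ means $\alpha_i=\alpha_j$ for every pair, so that $H_\alpha$ has a real realisation. Notation. $\mathbf{1}\in\mathbb{R}^n$ is the all-ones vector, $e_i$ the $i$-th canonical basis vector; $\mathrm{vec}$ stacks the columns of a matrix; $^*$ is complex conjugation, $^T$ transpose, $^H$ conjugate transpose, $\Vert\cdot\Vert_F$ the Frobenius norm, $\mathrm{tr}$ the trace, $\imath=\sqrt{-1}$.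 $\mathrm{atan}(z)=\frac1{2\imath}\left(\log(1+\imath z)-\log(1-\imath z)\right)$ with $\log$ the principal value of the complex logarithm. The mixed problem has binary variables $\alpha$ and real variables $d_\alpha$. Norm. $\Vert G\Vert_{2,\omega}=\sqrt{\frac1{2\pi}\int_{-\omega}^{\omega}\Vert G(\imath\nu)\Vert_F^2\,d\nu}$.
   Formalization: The sign of U_ω is corrected to e_i^T U_ω = +(2/π)a_ω(λ_i)vec(Φ_i)^T (the printed sign makes the claim false), and strict convexity is stated for controllable and observable (A,B,C) (it fails e.g. for B=0); real poles carry real residues. *)

(* Defs.v *)
From HB Require Import structures.
From mathcomp Require Import all_boot all_order all_algebra.
From mathcomp Require Import complex.
From mathcomp Require Import all_classical all_reals all_analysis.

Set Implicit Arguments.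
Unset Strict Implicit.
Unset Printing Implicit Defensive.

Import Order.TTheory GRing.Theory Num.Theory.
Import numFieldNormedType.Exports.

Local Open Scope classical_set_scope.
Local Open Scope ring_scope.
Local Open Scope sesquilinear_scope.

(* Throughout, R[i] carries MathComp's partial order: x <= y (resp. x < y) iff
   'Im x = 'Im y and 'Re x <= 'Re y (resp. 'Re x < 'Re y). *)

Definition cplx (R : realType) (x : R) : R[i] := real_complex R x.

Definition cplx_mx (R : realType) (p q : nat) (G : 'M[R]_(p, q)) :
  'M[R[i]]_(p, q) := map_mx (@cplx R) G.

(* Principal argument, in ]-pi, pi] (and acos 0 = pi / 2 at z = 0). *)
Definition carg (R : realType) (z : R[i]) : R :=
  let t := acos (complex.Re z / complex.Re `|z|) in
  if 0 <= complex.Im z then t else - t.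

Definition clog (R : realType) (z : R[i]) : R[i] :=
  Complex (ln (complex.Re `|z|)) (carg z).

Definition catan (R : realType) (z : R[i]) : R[i] :=
  (2%:R * 'i)^-1 * (clog (1 + 'i * z) - clog (1 - 'i * z)).

(* Column stacking; mxvec is the row-major enumeration, hence the inner
   transposition. *)
Definition vec (T : Type) (p q : nat) (G : 'M[T]_(p, q)) : 'cV[T]_(q * p) :=
  (mxvec G^T)^T.

Definition fro_norm (R : realType) (p q : nat) (G : 'M[R[i]]_(p, q)) : R :=
  Num.sqrt (\sum_(i < p) \sum_(j < q) (complex.Re `|G i j|) ^+ 2).

Definition h2w_norm (R : realType) (p q : nat) (w : R)
    (G : R[i] -> 'M[R[i]]_(p, q)) : R :=
  Num.sqrt ((2 * pi)^-1 *
    \int[lebesgue_measure]_(v in `[- w, w]) (fro_norm (G ('i * cplx v))) ^+ 2).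

Definition transfer (R : realType) (n nu ny : nat) (A : 'M[R]_n)
    (B : 'M[R]_(n, nu)) (C : 'M[R]_(ny, n)) (D : 'M[R]_(ny, nu)) (s : R[i]) :
    'M[R[i]]_(ny, nu) :=
  cplx_mx C *m invmx (s%:M - cplx_mx A) *m cplx_mx B + cplx_mx D.

Definition stable (R : realType) (n : nat) (A : 'M[R]_n) : Prop :=
  forall z : R[i], eigenvalue (cplx_mx A) z -> complex.Re z < 0.

Definition controllable (R : realType) (n nu : nat) (A : 'M[R]_n)
    (B : 'M[R]_(n, nu)) : Prop :=
  \rank (\mxrow_(k < n) (A ^+ k *m B)) = n.

Definition observable (R : realType) (n ny : nat) (A : 'M[R]_n)
    (C : 'M[R]_(ny, n)) : Prop :=
  \rank (\mxcol_(k < n) (C *m A ^+ k)) = n.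

Definition residue (R : realType) (n nu ny : nat) (X : 'M[R[i]]_n)
    (B : 'M[R]_(n, nu)) (C : 'M[R]_(ny, n)) (i : 'I_n) : 'M[R[i]]_(ny, nu) :=
  (cplx_mx C *m X) *m delta_mx i i *m (invmx X *m cplx_mx B).

(* For a semi-simple eigenvalue of multiplicity > 1 the residues depend on the
   choice of eigenvectors, so their conjugacy is a condition on that choice;
   in particular a real pole must carry a real residue. *)
Definition conjugate_pairs (R : realType) (n nu ny nc : nat)
    (lam : 'rV[R[i]]_n) (Phi : 'I_n -> 'M[R[i]]_(ny, nu))
    (ip jp : 'I_nc -> 'I_n) : Prop :=
  [/\ injective ip,
      injective jp,
      forall i, 0 < complex.Im (lam 0 i) <-> exists k, ip k = i,
      forall i, complex.Im (lam 0 i) < 0 <-> exists k, jp k = i &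
      [/\ forall k, lam 0 (jp k) = (lam 0 (ip k))^*,
          forall k, Phi (jp k) = map_mx Num.conj (Phi (ip k)) &
          forall i, complex.Im (lam 0 i) = 0 ->
            map_mx Num.conj (Phi i) = Phi i]].

Definition pair_mx (R : realType) (n nc : nat) (ip jp : 'I_nc -> 'I_n) :
    'M[R]_(nc, n) :=
  \matrix_(k < nc, l < n) ((l == ip k)%:R - (l == jp k)%:R).

Definition truncation (R : realType) (n nu ny : nat) (lam : 'rV[R[i]]_n)
    (Phi : 'I_n -> 'M[R[i]]_(ny, nu)) (alpha : 'cV[R]_n)
    (Da : 'M[R]_(ny, nu)) (s : R[i]) : 'M[R[i]]_(ny, nu) :=
  cplx_mx Da + \sum_(i < n) (cplx (alpha i 0) / (s - lam 0 i)) *: Phi i.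

Definition feasible (R : realType) (n nc r : nat) (M : 'M[R]_(nc, n))
    (alpha : 'cV[R]_n) : Prop :=
  [/\ forall i, alpha i 0 = 0 \/ alpha i 0 = 1,
      (const_mx 1 : 'cV[R]_n)^T *m alpha = (r%:R)%:M &
      M *m alpha = 0].

Definition is_minimizer (d : Order.disp_t) (V : porderType d) (T : Type)
    (F : T -> Prop) (f : T -> V) (x : T) : Prop :=
  F x /\ forall y, F y -> (f x <= f y)%O.

Section Quadratic.
Context (R : realType) (n nu ny : nat).
Context (lam : 'rV[R[i]]_n) (Phi : 'I_n -> 'M[R[i]]_(ny, nu)) (w : R).

Definition a_w (z : R[i]) : R[i] := catan (cplx w / z).

Definition Q_mx : 'M[R[i]]_n :=
  \matrix_(i < n, j < n)
    (\tr (Phi i *m (Phi j)^t*) / (- lam 0 i - (lam 0 j)^*)).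

Definition Qw_mx : 'M[R[i]]_n :=
  \matrix_(i < n, j < n)
    (- (cplx pi)^-1 * (a_w (lam 0 i) + a_w ((lam 0 j)^*)) * Q_mx i j).

(* As Re (lam i) < 0, the integral of ('i v - lam i)^-1 over [- w, w] equals
   - 2 a_w (lam i). The i-th row of U is the coefficient of dalpha in the cross
   term 1 / (2 pi) * (- 2) * integral of (vec (Phi i))^T dalpha / ('i v - lam i),
   the minus sign coming from D - Dalpha; hence the sign +, opposite to that of
   the D-part of the linear term. *)
Definition U_mx : 'M[R[i]]_(n, nu * ny) :=
  \matrix_(i < n) ((2%:R / cplx pi * a_w (lam 0 i)) *: (vec (Phi i))^T).

Definition Qcal_mx : 'M[R[i]]_(n + nu * ny) :=
  block_mx Qw_mx (2%:R^-1 *: U_mx)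
           (2%:R^-1 *: U_mx^t*) (cplx (w / pi))%:M.

Definition c_vec (d : 'cV[R]_(nu * ny)) : 'cV[R[i]]_(n + nu * ny) :=
  - (2%:R / cplx pi) *:
    col_mx (\col_(i < n) (a_w (lam 0 i) *
                          ((vec (Phi i))^T *m cplx_mx d) 0 0))
           (cplx w *: cplx_mx d).

End Quadratic.

(* Complex-valued in general: real when the entries of alpha agree on every
   conjugate pair. *)
Definition quad_obj (R : realType) (m : nat) (Q : 'M[R[i]]_m)
    (c : 'cV[R[i]]_m) (x : 'cV[R]_m) : R[i] :=
  ((cplx_mx x)^T *m Q *m cplx_mx x + c^T *m cplx_mx x) 0 0.

Definition x_vec (R : realType) (n k : nat) (alpha : 'cV[R]_n)
    (da : 'cV[R]_k) : 'cV[R]_(n + k) :=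
  col_mx (const_mx 1 - alpha) da.

Definition strictly_convex (R : realType) (m : nat) (f : 'cV[R]_m -> R[i]) :
    Prop :=
  forall (x y : 'cV[R]_m) (t : R), x != y -> 0 < t < 1 ->
    f (t *: x + (1 - t) *: y) < cplx t * f x + cplx (1 - t) * f y.

(* Main.v *)
(* For real x = (b, vec E), x^T Q x is the frequency-limited energy
     1/(2 pi) * int_{-w}^{w} || sum_i b_i Phi_i / (i v - lam_i) - E ||_F^2 dv.
   The integrand, expanded in partial fractions, is a linear combination of 1, of
   1 / (i v - lam_i) and of their conjugates, and
     v |-> atan ((v - Im lam) / - Re lam) - (i / 2) ln |i v - lam|^2
   is a primitive of 1 / (i v - lam) whose variation over [-w, w] is -2 a_w(lam).
   As the linear term is c = - 2 Q z with z = (0, vec D), completing the square shows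
   that the objective at x differs by a constant from the energy of x - z, which is
   the squared norm of H - H_alpha; the cross term is real because the modes of a
   feasible alpha come in conjugate pairs.

   A real x with x^T Q x = 0 makes sum_i b_i Phi_i / (s - lam_i) - E vanish on an
   interval of the imaginary axis, so E = 0 and the residues b_i Phi_i sum to 0 over
   each eigenvalue; the Hautus criterion then gives b = 0, hence strict convexity. *)

Require Import Defs.
From HB Require Import structures.
From mathcomp Require Import all_boot all_order all_algebra.
From mathcomp Require Import complex ring lra.
From mathcomp Require Import all_classical all_reals all_analysis.

Import Order.TTheory GRing.Theory Num.Theory.
Import numFieldNormedType.Exports.
Local Open Scope classical_set_scope.
Local Open Scope ring_scope.
Local Open Scope sesquilinear_scope.

(** * Primitives of complex-valued functions *)

Section Primitives.
Context {R : realType}.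
Implicit Types (F f G g : R -> R[i]) (a z : R[i]).

Lemma cImJ z : complex.Im z^* = - complex.Im z.
Proof. by case: z. Qed.
Lemma cReJ z : complex.Re z^* = complex.Re z.
Proof. by case: z. Qed.
Lemma cReD a z : complex.Re (a + z) = complex.Re a + complex.Re z.
Proof. by case: a; case: z. Qed.
Lemma cImD a z : complex.Im (a + z) = complex.Im a + complex.Im z.
Proof. by case: a; case: z. Qed.
Lemma cReN z : complex.Re (- z) = - complex.Re z.
Proof. by case: z. Qed.
Lemma cImN z : complex.Im (- z) = - complex.Im z.
Proof. by case: z. Qed.
Lemma cReM a z : complex.Re (a * z) = complex.Re a * complex.Re z - complex.Im a * complex.Im z.
Proof. by case: a; case: z. Qed.
Lemma cImM a z : complex.Im (a * z) = complex.Re a * complex.Im z + complex.Im a * complex.Re z.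
Proof. by case: a; case: z. Qed.
Lemma complex_eqP a z : complex.Re a = complex.Re z -> complex.Im a = complex.Im z -> a = z.
Proof. by case: a; case: z => ? ? ? ? /= -> ->. Qed.
Lemma imagE : 'i = Complex 0 1 :> R[i].
Proof. by []. Qed.

(* R[i] carries no normed module structure over R, so derivatives are taken on real
   and imaginary parts; the fundamental theorem of calculus needs the continuity. *)
Definition primitive_of F f : Prop :=
  [/\ forall v : R, is_derive v 1 (fun u => complex.Re (F u)) (complex.Re (f v)),
      forall v : R, is_derive v 1 (fun u => complex.Im (F u)) (complex.Im (f v)),
      continuous (fun v => complex.Re (f v)) &
      continuous (fun v => complex.Im (f v))].

Lemma primitive_of_eq F f g : f =1 g -> primitive_of F f -> primitive_of F g.
Proof. by move=> /funext ->. Qed.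

Lemma primitive_ofD F f G g : primitive_of F f -> primitive_of G g ->
  primitive_of (fun v => F v + G v) (fun v => f v + g v).
Proof.
move=> [F1 F2 f1 f2] [G1 G2 g1 g2]; split=> v.
- rewrite cReD; under eq_fun do rewrite cReD.
  exact: is_deriveD.
- rewrite cImD; under eq_fun do rewrite cImD.
  exact: is_deriveD.
- under eq_fun do rewrite cReD.
  by apply: cvgD; [exact: f1|exact: g1].
- under eq_fun do rewrite cImD.
  by apply: cvgD; [exact: f2|exact: g2].
Qed.

Lemma primitive_ofZ a F f : primitive_of F f ->
  primitive_of (fun v => a * F v) (fun v => a * f v).
Proof.
move=> [F1 F2 f1 f2]; split=> v.
- rewrite cReM; under eq_fun do rewrite cReM.
  by apply: is_deriveB; apply: is_deriveZ.
- rewrite cImM; under eq_fun do rewrite cImM.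
  by apply: is_deriveD; apply: is_deriveZ.
- under eq_fun do rewrite cReM.
  by apply: cvgB; apply: cvgZr; [exact: f1|exact: f2].
- under eq_fun do rewrite cImM.
  by apply: cvgD; apply: cvgZr; [exact: f2|exact: f1].
Qed.

Lemma primitive_ofJ F f : primitive_of F f ->
  primitive_of (fun v => (F v)^*) (fun v => (f v)^*).
Proof.
move=> [F1 F2 f1 f2]; split=> v.
- rewrite cReJ; under eq_fun do rewrite cReJ.
  exact: F1.
- rewrite cImJ; under eq_fun do rewrite cImJ.
  exact: is_deriveN.
- under eq_fun do rewrite cReJ.
  exact: f1.
- under eq_fun do rewrite cImJ.
  by apply: cvgN; exact: f2.
Qed.

Lemma primitive_of0 : primitive_of (fun=> 0) (fun=> 0).
Proof.
split=> v /=.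
- exact: is_derive_cst.
- exact: is_derive_cst.
- exact: cvg_cst.
- exact: cvg_cst.
Qed.

Lemma primitive_of_sum (I : Type) (r : seq I) (F f : I -> R -> R[i]) :
  (forall i, primitive_of (F i) (f i)) ->
  primitive_of (fun v => \sum_(i <- r) F i v) (fun v => \sum_(i <- r) f i v).
Proof.
move=> H; elim: r => [|i r IH].
  under eq_fun do rewrite big_nil.
  under [X in primitive_of _ X]eq_fun do rewrite big_nil.
  exact: primitive_of0.
under eq_fun do rewrite big_cons.
under [X in primitive_of _ X]eq_fun do rewrite big_cons.
exact: primitive_ofD.
Qed.

Lemma primitive_of_id : primitive_of (fun v => cplx v) (fun=> 1).
Proof.
split=> v /=.
- exact: is_derive_id.
- exact: is_derive_cst.
- exact: cvg_cst.
- exact: cvg_cst.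
Qed.

(** This is [- 'i * Log ('i v - z)]: for [Re z < 0] the point ['i v - z] stays in the right
    half-plane, where the principal argument is an arctangent and no branch cut is met. *)
Definition pole_prim z (v : R) : R[i] :=
  Complex (atan ((v - complex.Im z) / - complex.Re z))
    (- (2^-1 * ln ((complex.Re z) ^+ 2 + (v - complex.Im z) ^+ 2))).

Lemma primitive_of_pole z : complex.Re z < 0 ->
  primitive_of (pole_prim z) (fun v => ('i * cplx v - z)^-1).
Proof.
case: z => s t /= s0.
have D1 v : 0 < s ^+ 2 + (v - t) ^+ 2.
  by rewrite ltr_wpDr ?sqr_ge0// exprn_even_gt0//= lt_eqF.
have D0 v : s ^+ 2 + (v - t) ^+ 2 != 0 by rewrite gt_eqF.
have E v : ('i * cplx v - Complex s t)^-1 =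
    Complex (- s / (s ^+ 2 + (v - t) ^+ 2)) (- ((v - t) / (s ^+ 2 + (v - t) ^+ 2))).
  have -> : 'i * cplx v - Complex s t = Complex (- s) (v - t).
    by apply: complex_eqP; rewrite ?cReD ?cImD ?cReN ?cImN ?cReM ?cImM imagE /=; ring.
  by rewrite -[s ^+ 2]sqrrN; apply: complex_eqP.
have C v : {for v, continuous (fun u => (s ^+ 2 + (u - t) ^+ 2)^-1)}.
  apply: cvgV => //; apply: cvgD; first exact: cvg_cst.
  apply: (@continuous_comp _ _ _ (fun u => u - t) (fun x => x ^+ 2)).
    by apply: cvgB; [exact: cvg_id | exact: cvg_cst].
  exact: exprn_continuous.
apply: primitive_of_eq.
  by move=> v; rewrite E.
split=> v /=.
- have H : is_derive v 1 (fun u : R => (u - t) / - s) (- s)^-1.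
    have -> : (fun u : R => (u - t) / - s) = (- s)^-1 *: (fun u : R => u - t).
      by apply/funext => u; rewrite /= mulrC.
    by apply: is_derive_eq; rewrite subr0 /GRing.scale /= mulr1.
  have H' := @is_derive1_comp _ (@atan R) (fun u => (u - t) / - s) v _ _
    (is_derive1_atan _) H.
  have -> : - s / (s ^+ 2 + (v - t) ^+ 2) =
      (1 + ((v - t) / - s) ^+ 2)^-1 * (- s)^-1.
    by field; rewrite sqrrN D0 lt_eqF.
  exact: H'.
- have H : is_derive v 1 (fun u : R => s ^+ 2 + (u - t) ^+ 2) (2 * (v - t)).
    apply: is_derive_eq.
    rewrite /GRing.scale /= !subr0 !add0r; ring.
  have H' := @is_derive1_ln _ (s ^+ 2 + (v - t) ^+ 2) (D1 v).
  have H2 : is_derive v 1 (fun u => ln (s ^+ 2 + (u - t) ^+ 2))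
      (2 * (v - t) * (s ^+ 2 + (v - t) ^+ 2)^-1).
    have := @is_derive1_comp _ (@ln R) (fun u => s ^+ 2 + (u - t) ^+ 2) v _ _ H' H.
    by rewrite mulrC.
  apply: is_derive_eq.
  by rewrite /GRing.scale /=; field.
- by apply: cvgZr; exact: C.
- apply: cvgN; apply: cvgM; last exact: C.
  by apply: cvgB; [exact: cvg_id | exact: cvg_cst].
Qed.

(* Both sides are the angle between the vectors (1, x) and (1, y). *)
Lemma acos_atanB (x y : R) : y <= x ->
  acos ((1 + x * y) / (Num.sqrt (1 + x ^+ 2) * Num.sqrt (1 + y ^+ 2))) =
  atan x - atan y.
Proof.
move=> yx.
have sin_atan u : sin (atan u) = u * (Num.sqrt (1 + u ^+ 2))^-1.
  have c0 : cos (atan u) != 0.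
    by rewrite cos_atan invr_eq0 sqrtr_eq0 -ltNge ltr_wpDr ?sqr_ge0.
  by rewrite -cos_atan -{2}(atanK u) /tan -mulrA mulVf// mulr1.
have -> : (1 + x * y) / (Num.sqrt (1 + x ^+ 2) * Num.sqrt (1 + y ^+ 2)) =
    cos (atan x - atan y).
  by rewrite cosB !cos_atan !sin_atan invfM; ring.
rewrite cosK// in_itv/= subr_ge0 le_atan//=.
have := atan_ltpi2 x; have := atan_gtNpi2 y; lra.
Qed.

(** As [1 + 'i w / z = (z + 'i w) / z], the logarithm records the ratio of the moduli and the
    oriented angle from [z] to [z + 'i w]. Both points lie in the open left half-plane, so this
    angle is the principal one. Both signs of [w] are covered because [catan] involves [w] and
    [- w]. *)
Lemma clog_pole z (w : R) : complex.Re z < 0 ->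
  clog (1 + 'i * (cplx w / z)) =
  Complex (2^-1 * (ln ((complex.Re z) ^+ 2 + (w + complex.Im z) ^+ 2) -
                   ln ((complex.Re z) ^+ 2 + (complex.Im z) ^+ 2)))
          (atan (complex.Im z / - complex.Re z) -
           atan ((w + complex.Im z) / - complex.Re z)).
Proof.
case: z => s t /= s0.
have s2 : 0 < s ^+ 2 by rewrite exprn_even_gt0//= lt_eqF.
set m := s ^+ 2 + (w + t) ^+ 2; set n := s ^+ 2 + t ^+ 2.
have m0 : 0 < m by rewrite ltr_wpDr ?sqr_ge0.
have n0 : 0 < n by rewrite ltr_wpDr ?sqr_ge0.
have -> : 1 + 'i * (cplx w / Complex s t) = Complex ((n + w * t) / n) (w * s / n).
  have -> : (Complex s t)^-1 = Complex (s / n) (- (t / n)) by [].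
  have nn : n != 0 by rewrite gt_eqF.
  by apply: complex_eqP; rewrite ?cReD ?cImD ?cReM ?cImM imagE /=; field.
rewrite /clog /carg.
have -> : complex.Re `|Complex ((n + w * t) / n) (w * s / n)| = Num.sqrt (m / n).
  rewrite normc_def /=; congr Num.sqrt.
  by rewrite /m /n; field; rewrite gt_eqF.
congr Complex.
  rewrite -powR12_sqrt ?divr_ge0 ?ltW// ln_powR lnM ?posrE ?invr_gt0// lnV//.
have sm (u : R) : 1 + (u / - s) ^+ 2 = (s ^+ 2 + u ^+ 2) / s ^+ 2.
  by field; rewrite lt_eqF.
(* The cosine of the angle between [(s, u)] and [(s, v)], rescaled by [- s > 0] to the shape of
   [acos_atanB]. *)
have key u v : (s ^+ 2 + u * v) / Num.sqrt ((s ^+ 2 + u ^+ 2) * (s ^+ 2 + v ^+ 2)) =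
    (1 + (u / - s) * (v / - s)) /
    (Num.sqrt (1 + (u / - s) ^+ 2) * Num.sqrt (1 + (v / - s) ^+ 2)).
  rewrite !sm !sqrtrM ?addr_ge0 ?sqr_ge0// !sqrtrV ?sqr_ge0// sqrtr_sqr ltr0_norm//.
  have ? : Num.sqrt (s ^+ 2 + u ^+ 2) != 0 by rewrite sqrtr_eq0 -ltNge ltr_wpDr ?sqr_ge0.
  have ? : Num.sqrt (s ^+ 2 + v ^+ 2) != 0 by rewrite sqrtr_eq0 -ltNge ltr_wpDr ?sqr_ge0.
  have ? : s != 0 by rewrite lt_eqF.
  by field; apply/and3P; split.
rewrite /=.
have -> : (n + w * t) / n / Num.sqrt (m / n) = (s ^+ 2 + (w + t) * t) / Num.sqrt (m * n).
  rewrite !sqrtrM ?ltW// sqrtrV ?ltW// -{2}(sqr_sqrtr (ltW n0)).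
  have ? : Num.sqrt n != 0 by rewrite sqrtr_eq0 -ltNge.
  have ? : Num.sqrt m != 0 by rewrite sqrtr_eq0 -ltNge.
  by rewrite /n; field; apply/andP.
(* As [s < 0], the imaginary part [w * s / n] has the sign opposite to [w]: [carg] negates [acos]
   when [0 < w], and the two slopes exchange their order when [w <= 0]. *)
have [|] := ltP 0 w => w0.
- rewrite ifF; last first.
    by apply/negbTE; rewrite -ltNge pmulr_llt0 ?invr_gt0// pmulr_rlt0.
  by rewrite key acos_atanB ?opprB// ler_pM2r ?invr_gt0 ?oppr_gt0 // lerDr ltW.
- rewrite ifT; last by rewrite pmulr_lge0 ?invr_gt0// nmulr_lge0.
  rewrite (mulrC (w + t)) (mulrC m) key acos_atanB ?opprB//.
  by rewrite ler_pM2r ?invr_gt0 ?oppr_gt0 // gerDr.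
Qed.

(** The prefactor becomes [- 2 / (2 'i) = 'i], and [clog_pole] at [w] and at [- w] gives the two
    logarithms of [catan], in whose difference the contributions of [z] itself cancel. *)
Lemma pole_primB z (w : R) : complex.Re z < 0 ->
  pole_prim z w - pole_prim z (- w) = - 2 * a_w w z.
Proof.
move=> z0; rewrite /a_w /catan.
have -> : 1 - 'i * (cplx w / z) = 1 + 'i * (cplx (- w) / z).
  by rewrite /cplx rmorphN mulNr mulrN.
rewrite !clog_pole// mulrA invfM.
have -> : - 2%:R * (2%:R^-1 * 'i^-1) = 'i :> R[i].
  by rewrite mulrA mulNr divff ?pnatr_eq0// invCi mulN1r opprK.
case: z z0 => s t /= z0.
rewrite /pole_prim /=.
apply: complex_eqP; rewrite ?(cReD,cImD,cReM,cImM,cReN,cImN) imagE /=.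
  have -> : - w - t = - (w + t) by ring.
  have -> : w - t = - (- w + t) by ring.
  by rewrite !mulNr !atanN; ring.
have -> : (w - t) ^+ 2 = (- w + t) ^+ 2 by ring.
have -> : (- w - t) ^+ 2 = (w + t) ^+ 2 by ring.
by ring.
Qed.

(** ['i v - z^*] is the conjugate of ['i (- v) - z]; the sign comes from conjugating the factor
    [- 'i] in front of the logarithm. *)
Lemma pole_primJ z (w : R) : pole_prim z^* w = - (pole_prim z (- w))^*.
Proof.
case: z => s t; apply: complex_eqP; rewrite ?(cReN,cImN,cReJ,cImJ) /=.
  by rewrite -atanN -mulNr; congr (atan (_ / _)); ring.
by rewrite !opprK; congr (- (_ * ln (_ + _))); ring.
Qed.

(** Read off [pole_primB]: in [pole_primJ] the exchange of the endpoints [w] and [- w] and the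
    change of sign compensate. *)
Lemma a_wJ z (w : R) : complex.Re z < 0 -> a_w w z^* = (a_w w z)^*.
Proof.
move=> z0; have z0' : complex.Re z^* < 0 by rewrite cReJ.
have N2 : - 2 != 0 :> R[i] by rewrite oppr_eq0 pnatr_eq0.
apply: (mulfI N2); rewrite -pole_primB// !pole_primJ opprK.
have -> : - 2 * (a_w w z)^* = (- 2 * a_w w z)^*.
  by apply: complex_eqP; rewrite ?(cReJ,cImJ,cReM,cImM,cReN,cImN) /=; ring.
by rewrite -pole_primB// opprK rmorphB addrC.
Qed.

Lemma integral_primitive F f (w : R) : 0 < w -> primitive_of F f ->
  \int[lebesgue_measure]_(v in `[- w, w]) complex.Re (f v) =
  complex.Re (F w - F (- w)).
Proof.
move=> w0 [F1 _ f1 _]; rewrite cReD cReN.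
have Fc v : {for v, continuous (fun u => complex.Re (F u))}.
  apply: differentiable_continuous; apply/derivable1_diffP.
  exact: ex_derive.
rewrite /Rintegral (@continuous_FTC2 _ _ (fun v => complex.Re (F v)))//.
- by rewrite (le_lt_trans _ w0)// oppr_le0 ltW.
- by apply: continuous_subspaceT.
- split.
  + by move=> v _; exact: ex_derive.
  + by apply: cvg_at_right_filter; exact: Fc.
  + by apply: cvg_at_left_filter; exact: Fc.
- by move=> v _; rewrite derive1E; exact: derive_val.
Qed.

End Primitives.

HB.instance Definition _ (R : realType) := GRing.RMorphism.copy (@cplx R) (real_complex R).

(** * The quadratic form as an energy *)

Lemma vec_dot (S : comNzRingType) (p q : nat) (G H : 'M[S]_(p, q)) :
  \sum_k vec G k 0 * vec H k 0 = \sum_i \sum_j G i j * H i j.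
Proof.
rewrite exchange_big/= pair_big/=.
rewrite (reindex _ (curry_mxvec_bij q p)).
by apply: eq_bigr => -[i j] _ /=; rewrite !mxE !mxvecE !mxE.
Qed.

Lemma exchange_sum4 (S : pzSemiRingType) (I J K L : finType) (c : I -> J -> S)
    (f : I -> J -> K -> L -> S) :
  \sum_i \sum_j c i j * (\sum_k \sum_l f i j k l) =
  \sum_k \sum_l \sum_i \sum_j c i j * f i j k l.
Proof.
under eq_bigr => i _ do under eq_bigr => j _ do
  (rewrite mulr_sumr; under eq_bigr => k _ do rewrite mulr_sumr).
under eq_bigr => i _ do rewrite exchange_big/=.
rewrite exchange_big/=; apply: eq_bigr => k _.
under eq_bigr => i _ do rewrite exchange_big/=.
by rewrite exchange_big.
Qed.

(** On real vectors transposition is conjugate transposition, so this is at once bilinear over the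
    reals and the sesquilinear form of [Q]. *)
Definition bform {R : realType} {m : nat} (Q : 'M[R[i]]_m) (x y : 'cV[R]_m) : R[i] :=
  ((cplx_mx x)^T *m Q *m cplx_mx y) 0 0.

Definition qform {R : realType} {m : nat} (Q : 'M[R[i]]_m) (x : 'cV[R]_m) : R[i] :=
  bform Q x x.

Section Energy.
Context {R : realType}.

Lemma cplx_fro_norm (p q : nat) (G : 'M[R[i]]_(p, q)) :
  cplx (fro_norm G ^+ 2) = \sum_i \sum_j G i j * (G i j)^*.
Proof.
rewrite /fro_norm sqr_sqrtr; last first.
  by apply: sumr_ge0 => i _; apply: sumr_ge0 => j _; exact: sqr_ge0.
rewrite rmorph_sum; apply: eq_bigr => i _; rewrite rmorph_sum; apply: eq_bigr => j _.
by rewrite -normCK normc_def rmorphXn.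
Qed.

Lemma cplxJ (x : R) : (cplx x)^* = cplx x.
Proof. by apply: complex_eqP; rewrite ?cReJ ?cImJ //= oppr0. Qed.

Lemma conjM (x y : R[i]) : (x * y)^* = x^* * y^*.
Proof. exact: rmorphM. Qed.

Lemma conjD (x y : R[i]) : (x + y)^* = x^* + y^*.
Proof. exact: rmorphD. Qed.

Lemma conjN (x : R[i]) : (- x)^* = - x^*.
Proof. exact: rmorphN. Qed.

Lemma conjV (x : R[i]) : (x^-1)^* = (x^*)^-1.
Proof. exact: fmorphV. Qed.

Lemma cplxJinv (x : R) : ((cplx x)^-1)^* = (cplx x)^-1.
Proof. by rewrite fmorphV/= cplxJ. Qed.

Lemma pole_neq0 (z : R[i]) (v : R) : complex.Re z < 0 -> 'i * cplx v - z != 0.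
Proof.
move=> z0; apply/eqP => /(congr1 (@complex.Re R)).
by rewrite cReD cReN cReM imagE /=; lra.
Qed.

Lemma pole_invJ (z : R[i]) (v : R) :
  (('i * cplx v - z)^-1)^* = (- 'i * cplx v - z^*)^-1.
Proof.
rewrite fmorphV; congr (_^-1).
by apply: complex_eqP;
  rewrite !(cReJ,cImJ,cReD,cImD,cReN,cImN,cReM,cImM) imagE /=; ring.
Qed.

(** With [x = 'i v - lam_i] and [y = - 'i v - lam_j^*], the sum [x + y = - lam_i - lam_j^*] has
    positive real part and [1 / (x y) = (1 / x + 1 / y) / (x + y)], which splits each product of two
    modes into functions with known primitives. *)
Lemma primitive_of_sqnorm (n : nat) (lam : 'rV[R[i]]_n) (b : 'I_n -> R[i]) (d : R[i])
    (g := fun v : R => \sum_i b i / ('i * cplx v - lam 0 i) - d) :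
  (forall i, complex.Re (lam 0 i) < 0) ->
  primitive_of (fun v =>
    (\sum_i \sum_j b i * (b j)^* / (- lam 0 i - (lam 0 j)^*) *
       (pole_prim (lam 0 i) v + (pole_prim (lam 0 j) v)^*))
     + (- d^* * \sum_i b i * pole_prim (lam 0 i) v)
     + (- d * (\sum_i b i * pole_prim (lam 0 i) v)^*) + d * d^* * cplx v)
   (fun v => g v * (g v)^*).
Proof.
move=> lam0; pose e i v := ('i * cplx v - lam 0 i)^-1.
have P i : primitive_of (pole_prim (lam 0 i)) (e i) by exact: primitive_of_pole.
have S : primitive_of (fun v => \sum_i b i * pole_prim (lam 0 i) v)
    (fun v => \sum_i b i * e i v).
  by apply: primitive_of_sum => i; exact: primitive_ofZ.
apply: (@primitive_of_eq _ _ (fun v =>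
    (\sum_i \sum_j b i * (b j)^* / (- lam 0 i - (lam 0 j)^*) *
       (e i v + (e j v)^*))
     + (- d^* * \sum_i b i * e i v)
     + (- d * (\sum_i b i * e i v)^*) + d * d^* * 1)).
  move=> v; rewrite /g; set s := \sum_i b i * e i v.
  have -> : \sum_i \sum_j b i * (b j)^* / (- lam 0 i - (lam 0 j)^*) *
       (e i v + (e j v)^*) = s * s^*.
    rewrite /s rmorph_sum big_distrlr/=; apply: eq_bigr => i _; apply: eq_bigr => j _.
    rewrite rmorphM/= /e !pole_invJ.
    have N1 : 'i * cplx v - lam 0 i != 0 by exact: pole_neq0.
    have N2 : - 'i * cplx v - (lam 0 j)^* != 0.
      by rewrite -invr_eq0 -pole_invJ conjC_eq0 invr_eq0 pole_neq0.
    have N3 : - lam 0 i - (lam 0 j)^* != 0.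
      apply/eqP => /(congr1 (@complex.Re R)).
      rewrite cReD !cReN cReJ /=; have := lam0 i; have := lam0 j; lra.
    by field; apply/and3P.
  by rewrite rmorphB/=; ring.
apply: primitive_ofD; last by apply: primitive_ofZ; exact: primitive_of_id.
apply: primitive_ofD; last by apply: primitive_ofZ; apply: primitive_ofJ.
apply: primitive_ofD; last exact: primitive_ofZ.
apply: primitive_of_sum => i; apply: primitive_of_sum => j; apply: primitive_ofZ.
by apply: primitive_ofD => //; apply: primitive_ofJ.
Qed.

Context {n nu ny : nat} (lam : 'rV[R[i]]_n) (Phi : 'I_n -> 'M[R[i]]_(ny, nu)) (w : R).

(** With [b = 1 - alpha] and [E = Dalpha - D] this is [H - H_alpha]. *)
Definition modal_error (b : 'cV[R]_n) (E : 'M[R]_(ny, nu)) (s : R[i]) :=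
  \sum_i (cplx (b i 0) / (s - lam 0 i)) *: Phi i - cplx_mx E.

Hypothesis lam0 : forall i, complex.Re (lam 0 i) < 0.

(** Expanded entry by entry, so that each summand over [p] and [q] is half the variation over
    [[- w, w]] of the primitive in [primitive_of_sqnorm]. *)
Lemma qform_Qcal (b : 'cV[R]_n) (E : 'M[R]_(ny, nu)) :
  qform (Qcal_mx lam Phi w) (col_mx b (vec E)) =
  (cplx pi)^-1 * \sum_p \sum_q
   ((\sum_i \sum_j
       cplx (b i 0) * Phi i p q * (cplx (b j 0) * Phi j p q)^* / (- lam 0 i - (lam 0 j)^*)
       * - (a_w w (lam 0 i) + (a_w w (lam 0 j))^*))
    + cplx (E p q) * (\sum_i cplx (b i 0) * Phi i p q * a_w w (lam 0 i))
    + cplx (E p q) * (\sum_i cplx (b i 0) * Phi i p q * a_w w (lam 0 i))^*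
    + cplx w * cplx (E p q) * cplx (E p q)).
Proof.
have pi0 : cplx pi != 0 :> R[i] by rewrite fmorph_eq0 gt_eqF ?pi_gt0.
rewrite /qform /bform /Qcal_mx /cplx_mx map_col_mx tr_col_mx mul_row_block mul_row_col.
rewrite !mulmxDl !mxE.
have vecC : map_mx (@cplx R) (vec E) = vec (map_mx (@cplx R) E).
  by rewrite /vec map_trmx -map_mxvec map_trmx.
(* The same sum grouped by the blocks of [Qcal_mx], with the modes outside and the matrix entries
   inside. *)
rewrite [X in _ = _ * X](_ : _ =
  (\sum_i \sum_j cplx (b i 0) * cplx (b j 0) *
       (\sum_p \sum_q Phi i p q * (Phi j p q)^*) / (- lam 0 i - (lam 0 j)^*)
       * - (a_w w (lam 0 i) + (a_w w (lam 0 j))^*))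
   + (\sum_i cplx (b i 0) * a_w w (lam 0 i) * \sum_p \sum_q Phi i p q * cplx (E p q))
   + (\sum_i cplx (b i 0) * a_w w (lam 0 i) * \sum_p \sum_q Phi i p q * cplx (E p q))^*
   + cplx w * (\sum_p \sum_q cplx (E p q) * cplx (E p q))); last first.
  have S1 : \sum_i cplx (b i 0) * a_w w (lam 0 i) * (\sum_p \sum_q Phi i p q * cplx (E p q))
    = \sum_p \sum_q cplx (E p q) * (\sum_i cplx (b i 0) * Phi i p q * a_w w (lam 0 i)) :> R[i].
    under eq_bigr do rewrite mulr_sumr.
    rewrite exchange_big/=; apply: eq_bigr => p _.
    under eq_bigr do rewrite mulr_sumr.
    rewrite exchange_big/=; apply: eq_bigr => q _.
    by rewrite mulr_sumr; apply: eq_bigr => i _; ring.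
  rewrite S1 rmorph_sum.
  have -> : \sum_i \sum_j cplx (b i 0) * cplx (b j 0) *
       (\sum_p \sum_q Phi i p q * (Phi j p q)^*) / (- lam 0 i - (lam 0 j)^*)
       * - (a_w w (lam 0 i) + (a_w w (lam 0 j))^*) =
     \sum_p \sum_q \sum_i \sum_j
       cplx (b i 0) * Phi i p q * (cplx (b j 0) * Phi j p q)^* / (- lam 0 i - (lam 0 j)^*)
       * - (a_w w (lam 0 i) + (a_w w (lam 0 j))^*) :> R[i].
    transitivity (\sum_i \sum_j
       (cplx (b i 0) * cplx (b j 0) / (- lam 0 i - (lam 0 j)^*)
        * - (a_w w (lam 0 i) + (a_w w (lam 0 j))^*)) *
       (\sum_p \sum_q Phi i p q * (Phi j p q)^*)).
      by apply: eq_bigr => i _; apply: eq_bigr => j _; ring.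
    rewrite exchange_sum4.
    apply: eq_bigr => p _; apply: eq_bigr => q _.
    apply: eq_bigr => i _; apply: eq_bigr => j _.
    by rewrite (conjM (cplx _)) cplxJ; ring.
  rewrite mulr_sumr -!big_split/=; apply: eq_bigr => p _.
  rewrite rmorph_sum/= mulr_sumr -!big_split/=; apply: eq_bigr => q _.
  by rewrite (conjM (cplx _)) cplxJ mulrA.
rewrite !mulrDr.
set T := \sum_i cplx (b i 0) * a_w w (lam 0 i) * _.
have two0 : 2 != 0 :> R[i] by rewrite pnatr_eq0.
(* The upper right block gives [T / pi], its factor 1/2 cancelling the 2 of [U_mx]; the lower left
   block gives the conjugate, [b] and [E] being real. *)
have T2 : \sum_j ((map_mx (@cplx R) b)^T *m (2%:R^-1 *: U_mx lam Phi w)) 0 j *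
    map_mx (@cplx R) (vec E) j 0 = (cplx pi)^-1 * T.
  under eq_bigr do rewrite !mxE mulr_suml.
  rewrite exchange_big/= /T mulr_sumr; apply: eq_bigr => i _.
  have -> : \sum_p \sum_q Phi i p q * cplx (E p q) =
      \sum_k vec (Phi i) k 0 * map_mx (@cplx R) (vec E) k 0.
    rewrite vecC vec_dot.
    by apply: eq_bigr => p _; apply: eq_bigr => q _; rewrite [map_mx _ _ _ _]mxE.
  rewrite !mulr_sumr; apply: eq_bigr => k _.
  by rewrite !mxE; move: (cplx pi) pi0 => P P0; field.
have T3 : \sum_j ((map_mx (@cplx R) (vec E))^T *m (2%:R^-1 *: (U_mx lam Phi w)^t*)) 0 j *
    map_mx (@cplx R) b j 0 = (cplx pi)^-1 * T^*.
  rewrite -[(cplx pi)^-1]cplxJinv -conjM -T2 rmorph_sum/=.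
  under [RHS]eq_bigr do rewrite !mxE mulr_suml rmorph_sum/=.
  rewrite exchange_big/=; apply: eq_bigr => i _.
  rewrite !mxE mulr_suml; apply: eq_bigr => k _.
  rewrite !mxE; move: (a_w w (lam 0 i)) => a.
  rewrite !conjM !cplxJ !cplxJinv fmorphV !rmorph_nat.
  ring.
rewrite T2 T3 addrACA addrA; congr (_ + _ + _ + _).
- under eq_bigr do rewrite !mxE mulr_suml.
  rewrite exchange_big/= mulr_sumr; apply: eq_bigr => i _.
  rewrite mulr_sumr; apply: eq_bigr => j _.
  rewrite !mxE a_wJ//.
  have -> : \tr (Phi i *m (Phi j)^t*) = \sum_p \sum_q Phi i p q * (Phi j p q)^*.
    by apply: eq_bigr => p _; rewrite mxE; apply: eq_bigr => q _; rewrite !mxE.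
  ring.
- rewrite mul_mx_scalar.
  have -> : \sum_p \sum_q cplx (E p q) * cplx (E p q) =
      \sum_k map_mx (@cplx R) (vec E) k 0 * map_mx (@cplx R) (vec E) k 0.
    rewrite vecC vec_dot.
    by apply: eq_bigr => p _; apply: eq_bigr => q _; rewrite [map_mx _ _ _ _]mxE.
  rewrite !mulr_sumr; apply: eq_bigr => k _.
  by rewrite !mxE rmorphM fmorphV/=; ring.
Qed.
End Energy.

(** * Energy of the modal error over the frequency interval *)

Section ModalError.
Context {R : realType} {n nu ny : nat}.
Context (lam : 'rV[R[i]]_n) (Phi : 'I_n -> 'M[R[i]]_(ny, nu)) (w : R).
Hypothesis lam0 : forall i, complex.Re (lam 0 i) < 0.

(** The primitive itself is exported because it serves twice: its variation gives the integral, and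
    its monotonicity gives definiteness. *)
Lemma modal_error_primitive (b : 'cV[R]_n) (E : 'M[R]_(ny, nu)) :
  exists2 F : R -> R[i],
    primitive_of F (fun v => cplx (fro_norm (modal_error lam Phi b E ('i * cplx v)) ^+ 2)) &
    F w - F (- w) = cplx (2 * pi) * qform (Qcal_mx lam Phi w) (col_mx b (vec E)).
Proof.
pose f p q v := \sum_i (cplx (b i 0) * Phi i p q) / ('i * cplx v - lam 0 i) - cplx (E p q).
have fE v p q : modal_error lam Phi b E ('i * cplx v) p q = f p q v.
  rewrite !mxE summxE; congr (_ - _).
  by apply: eq_bigr => i _; rewrite mxE mulrAC.
pose P p q := primitive_of_sqnorm _ lam (fun i => cplx (b i 0) * Phi i p q) (cplx (E p q)) lam0.
eexists.
  apply: (@primitive_of_eq _ _ (fun v => \sum_p \sum_q f p q v * (f p q v)^*)).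
    move=> v; rewrite cplx_fro_norm; apply: eq_bigr => p _; apply: eq_bigr => q _.
    by rewrite fE.
  apply: primitive_of_sum => p; apply: primitive_of_sum => q; exact: P.
have pi0 : cplx pi != 0 :> R[i] by rewrite fmorph_eq0 gt_eqF ?pi_gt0.
rewrite qform_Qcal // (rmorphM (@cplx R)) -mulrA mulVKf//.
rewrite -sumrB mulr_sumr; apply: eq_bigr => p _.
rewrite -sumrB mulr_sumr; apply: eq_bigr => q _.
have c2 : (2 : R[i])^* = 2 by exact: rmorph_nat.
have C2 : cplx 2 = 2 :> R[i] by rewrite (rmorph_nat (@cplx R)).
have PB i : pole_prim (lam 0 i) w = pole_prim (lam 0 i) (- w) - 2 * a_w w (lam 0 i).
  by rewrite -[LHS](subrK (pole_prim (lam 0 i) (- w))) pole_primB// addrC mulNr.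
set c := fun i => cplx (b i 0) * Phi i p q.
have S1 : \sum_i c i * pole_prim (lam 0 i) w =
    \sum_i c i * pole_prim (lam 0 i) (- w) - 2 * \sum_i c i * a_w w (lam 0 i).
  rewrite mulr_sumr -sumrB; apply: eq_bigr => i _; rewrite PB.
  by rewrite mulrBr mulrCA.
have S2 : \sum_i \sum_j c i * (c j)^* / (- lam 0 i - (lam 0 j)^*) *
      (pole_prim (lam 0 i) w + (pole_prim (lam 0 j) w)^*) =
    \sum_i \sum_j c i * (c j)^* / (- lam 0 i - (lam 0 j)^*) *
      (pole_prim (lam 0 i) (- w) + (pole_prim (lam 0 j) (- w))^*) +
    2 * \sum_i \sum_j c i * (c j)^* / (- lam 0 i - (lam 0 j)^*) *
      - (a_w w (lam 0 i) + (a_w w (lam 0 j))^*).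
  rewrite mulr_sumr -big_split/=; apply: eq_bigr => i _.
  rewrite mulr_sumr -big_split/=; apply: eq_bigr => j _.
  rewrite !PB rmorphB/= (conjM 2) c2.
  move: (a_w w (lam 0 i)) (a_w w (lam 0 j))^* => x y.
  move: (pole_prim _ _) (pole_prim _ _)^* (_ / _) => u v z; ring.
rewrite S2 S1 rmorphB/= (conjM 2) c2 C2 cplxJ (rmorphN (@cplx R)).
move: (\sum_i \sum_j _) (\sum_i \sum_j _) => x1 x2.
move: (\sum_i _) (\sum_i _) => x3 x4; ring.
Qed.
End ModalError.

(** * Eigenvectors, controllability and observability *)

Section Hautus.
Context {R : realType} {n : nat} (A : 'M[R]_n).

Lemma cplx_mx_expl (k : nat) (u : 'cV[R[i]]_n) (mu : R[i]) :
  cplx_mx A *m u = mu *: u -> cplx_mx (A ^+ k) *m u = mu ^+ k *: u.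
Proof.
move=> Au; elim: k => [|k IH].
  by rewrite !expr0 scale1r /cplx_mx map_mx1 mul1mx.
by rewrite !exprSr -mulmxE /cplx_mx map_mxM -mulmxA Au -scalemxAr IH scalerA mulrC.
Qed.

Lemma cplx_mx_expr (k : nat) (u : 'rV[R[i]]_n) (mu : R[i]) :
  u *m cplx_mx A = mu *: u -> u *m cplx_mx (A ^+ k) = mu ^+ k *: u.
Proof.
move=> uA; elim: k => [|k IH].
  by rewrite !expr0 scale1r /cplx_mx map_mx1 mulmx1.
by rewrite !exprS -mulmxE /cplx_mx map_mxM mulmxA uA -scalemxAl IH scalerA mulrC.
Qed.

(** Easy half of the Hautus criterion: [C A^k u = mu^k C u = 0] for every [k], and a real left
    inverse of the observability matrix, cut into blocks, recovers [u] from these vectors. *)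
Lemma observable_eigenvector (ny : nat) (C : 'M[R]_(ny, n)) (u : 'cV[R[i]]_n) (mu : R[i]) :
  observable A C -> cplx_mx A *m u = mu *: u -> cplx_mx C *m u = 0 -> u = 0.
Proof.
move=> obs Au Cu.
have /row_fullP[L LO] : row_full (\mxcol_(k < n) (C *m A ^+ k)) by apply/eqP.
rewrite -(submxrowK L) mul_mxrow_mxcol in LO.
rewrite -[u]mul1mx -(map_mx1 (@cplx R)) -LO raddf_sum/= mulmx_suml big1// => k _.
rewrite !map_mxM -!mulmxA [X in _ *m (_ *m X)](cplx_mx_expl _ _ _ Au).
by rewrite -!scalemxAr [X in _ *m X]Cu mulmx0 scaler0.
Qed.

Lemma controllable_eigenvector (nu : nat) (B : 'M[R]_(n, nu)) (u : 'rV[R[i]]_n) (mu : R[i]) :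
  controllable A B -> u *m cplx_mx A = mu *: u -> u *m cplx_mx B = 0 -> u = 0.
Proof.
move=> ctr uA uB.
have /row_freeP[L OL] : row_free (\mxrow_(k < n) (A ^+ k *m B)) by apply/eqP.
rewrite -(submxcolK L) mul_mxrow_mxcol in OL.
rewrite -[u]mulmx1 -(map_mx1 (@cplx R)) -OL raddf_sum/= mulmx_sumr big1// => k _.
rewrite !map_mxM !mulmxA [X in X *m _ *m _](cplx_mx_expr _ _ _ uA).
by rewrite -!scalemxAl [X in X *m _]uB mul0mx scaler0.
Qed.

Context {nu ny : nat} (B : 'M[R]_(n, nu)) (C : 'M[R]_(ny, n)).
Context (X : 'M[R[i]]_n) (lam : 'rV[R[i]]_n).
Hypothesis Xunit : X \in unitmx.
Hypothesis AX : cplx_mx A *m X = X *m diag_mx lam.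

Lemma residueE i p q :
  residue X B C i p q = (cplx_mx C *m X) p i * (invmx X *m cplx_mx B) i q.
Proof.
(* [delta_mx i i] is factored through dimension 1 as [e_i e_i^T], which exhibits the residue as a
   column times a row. *)
rewrite /residue -(mul_delta_mx (0 : 'I_1)) !mulmxA -colE -mulmxA -mulmxA.
rewrite [delta_mx 0 i *m _]mulmxA.
by rewrite -rowE -row_mul mxE big_ord1 mxE [row _ _ _ _]mxE.
Qed.

Lemma left_eigenrow i :
  row i (invmx X) *m cplx_mx A = lam 0 i *: row i (invmx X).
Proof.
rewrite -row_mul -[cplx_mx A](mulmxK Xunit) AX !mulmxA mulVmx// mul1mx.
by rewrite row_mul row_diag_mx -scalemxAl -rowE.
Qed.

Lemma stable_pole i : stable A -> complex.Re (lam 0 i) < 0.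
Proof.
(* [eigenvalue] refers to row eigenvectors, hence the rows of [invmx X]. *)
move=> stA; apply: stA; apply/eigenvalueP; exists (row i (invmx X)).
  exact: left_eigenrow.
apply/eqP => r0; have := congr1 (mulmx^~ X) r0.
rewrite -row_mul mulVmx// mul0mx => /rowP/(_ i)/eqP.
by rewrite !mxE eqxx oner_eq0.
Qed.

(** Fix [i] and an input [q]. The vector [v] keeps the modes sharing the pole [lam_i], so [A] acts
    on [X v] as [lam_i] and [C] kills it; observability gives [v = 0], whence [b_i] times row [i] of
    [X^-1 B] is 0. If [b_i] were nonzero, the left eigenvector [row i (invmx X)] would be killed by
    [B], against controllability. *)
Lemma residue_combination_eq0 (b : 'I_n -> R[i]) :
  controllable A B -> observable A C ->
  (forall mu p q, \sum_(i | lam 0 i == mu) b i * residue X B C i p q = 0) ->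
  forall i, b i = 0.
Proof.
move=> ctr obs H i; set Y := invmx X *m cplx_mx B.
have bY q : b i * Y i q = 0.
  set v : 'cV[R[i]]_n := \col_j (if lam 0 j == lam 0 i then b j * Y j q else 0).
  suff v0 : v = 0.
    by have /colP/(_ i) := v0; rewrite !mxE eqxx.
  have dv : diag_mx lam *m v = lam 0 i *: v.
    apply/colP => j; rewrite mul_diag_mx !mxE.
    by case: eqP => [->//|_]; rewrite !mulr0.
  have Xv : X *m v = 0.
    apply: (@observable_eigenvector _ C _ (lam 0 i)) => //.
      by rewrite mulmxA AX -mulmxA dv scalemxAr.
    rewrite mulmxA; apply/colP => p; rewrite mxE [RHS]mxE.
    apply: etrans (H (lam 0 i) p q); rewrite [RHS]big_mkcond/=; apply: eq_bigr => j _.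
    by rewrite [v _ _]mxE residueE; case: eqP => _; rewrite ?mulr0// mulrCA.
  by rewrite -(mulKmx Xunit v) Xv mulmx0.
have [//|b0] := eqVneq (b i) 0.
have Yi : row i (invmx X) *m cplx_mx B = 0.
  apply/rowP => q; rewrite -row_mul mxE [RHS]mxE.
  by apply: (mulfI b0); rewrite bY mulr0.
have r0 := controllable_eigenvector _ _ _ _ ctr (left_eigenrow i) Yi.
have := congr1 (mulmx^~ X) r0.
rewrite -row_mul mulVmx// mul0mx => /rowP/(_ i)/eqP.
by rewrite !mxE eqxx oner_eq0.
Qed.

Lemma transferE (D : 'M[R]_(ny, nu)) (s : R[i]) :
  (forall i, s - lam 0 i != 0) ->
  transfer A B C D s = cplx_mx D + \sum_i (s - lam 0 i)^-1 *: residue X B C i.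
Proof.
move=> s0; rewrite /transfer addrC; congr (_ + _).
set d : 'rV[R[i]]_n := \row_i (s - lam 0 i).
have dE : s%:M - cplx_mx A = X *m diag_mx d *m invmx X.
  rewrite -[cplx_mx A](mulmxK Xunit) AX -[s%:M](mulmxK Xunit) -scalar_mxC -mulmxBl -mulmxBr.
  congr (_ *m _ *m _); apply/matrixP => i j; rewrite !mxE.
  by rewrite mulrnBl.
set e : 'rV[R[i]]_n := \row_i (s - lam 0 i)^-1.
have de : diag_mx d *m diag_mx e = 1%:M.
  rewrite mulmx_diag -diag_const_mx; congr diag_mx; apply/rowP => i.
  by rewrite !mxE divff.
have -> : invmx (s%:M - cplx_mx A) = X *m diag_mx e *m invmx X.
  have E1 : (s%:M - cplx_mx A) *m (X *m diag_mx e *m invmx X) = 1%:M.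
    rewrite dE !mulmxA mulmxKV// -(mulmxA X) de mulmx1 mulmxV//.
  have /mulmx1_unit[U _] := E1.
  by rewrite -[RHS](mulKmx U) E1 mulmx1.
apply/matrixP => p q; rewrite summxE !mulmxA -[LHS]/(_ p q) -mulmxA mxE.
apply: eq_bigr => i _; rewrite [RHS]mxE residueE mul_mx_diag.
by rewrite [X in X * _]mxE [e _ _]mxE mulrAC mulrC mulrA.
Qed.
End Hautus.

(** * Hermitian symmetry and positivity *)

(* Clearing denominators gives a polynomial with infinitely many roots, which is then
   evaluated at each pole. *)
Lemma partial_fraction_eq0 (F : fieldType) (n : nat) (lam c : 'I_n -> F) (d : F)
    (x : nat -> F) : injective x -> (forall k i, x k != lam i) ->
  (forall k, \sum_i c i / (x k - lam i) = d) ->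
  d = 0 /\ forall mu, \sum_(i | lam i == mu) c i = 0.
Proof.
move=> xinj xlam H.
(* Each distinct pole is taken once, so that [P] has simple roots and [P' mu] does not vanish at
   [mu]. *)
pose s := undup [seq lam i | i : 'I_n].
have us : uniq s by exact: undup_uniq.
have sin i : lam i \in s by rewrite mem_undup; apply/mapP; exists i; rewrite ?mem_enum.
pose P : {poly F} := \prod_(mu <- s) ('X - mu%:P).
pose P' mu : {poly F} := \prod_(nu <- s | nu != mu) ('X - nu%:P).
have P'E mu : mu \in s -> P = ('X - mu%:P) * P' mu by move=> ms; rewrite /P (bigD1_seq mu).
pose S mu := \sum_(i | lam i == mu) c i.
(* Numerator of the sum of fractions minus [d], over the common denominator [P]. *)
pose N := \sum_(mu <- s) S mu *: P' mu - d *: P.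
have Nx k : N.[x k] = 0.
  rewrite /N hornerD hornerN hornerZ -[d](H k) horner_sum mulr_suml.
  apply/eqP; rewrite subr_eq0; apply/eqP.
  under eq_bigr => mu _ do rewrite hornerZ /S mulr_suml.
  rewrite (exchange_big_dep predT)//=; apply: eq_bigr => i _.
  rewrite big_mkcond/= (bigD1_seq (lam i))//= eqxx big1 ?addr0; last first.
    by move=> mu; rewrite eq_sym => /negPf ->.
  rewrite (P'E _ (sin i)) hornerM hornerXsubC mulrA divfK//.
  by rewrite subr_eq0.
have N0 : N = 0.
  apply/eqP; apply: contraT => N0.
  pose rs := [seq x k | k <- iota 0 (size N)].
  have := max_poly_roots N0 (rs := rs).
  rewrite size_map size_iota ltnn => -> //.
    by apply/allP => _ /mapP[k _ ->]; apply/rootP.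
  by rewrite map_inj_uniq// iota_uniq.
(* At [mu] every term of [N] vanishes except [S mu *: P' mu]. *)
have S0 mu : mu \in s -> S mu = 0.
  move=> ms; have := congr1 (horner^~ mu) N0.
  rewrite /N hornerD hornerN hornerZ horner0 (P'E mu)// hornerM hornerXsubC.
  rewrite subrr mul0r mulr0 subr0 horner_sum (bigD1_seq mu)//= big1 ?addr0; last first.
    move=> nu num; rewrite hornerZ /P' big_mkcond/= (bigD1_seq mu)//= eq_sym num.
    by rewrite hornerM hornerXsubC subrr mul0r mulr0.
  move/eqP; rewrite hornerZ mulf_eq0 => /orP[/eqP//|].
  by rewrite /P' horner_prod prodf_seq_eq0 => /hasP[nu _ /andP[/negPf]];
    rewrite hornerXsubC subr_eq0 eq_sym => ->.
split.
  have : d *: P = 0.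
    have := N0; rewrite /N big_seq big1 ?sub0r; last by move=> mu ms; rewrite S0 ?scale0r.
    by move/eqP; rewrite oppr_eq0 => /eqP.
  move/eqP; rewrite scaler_eq0 => /orP[/eqP//|].
  by rewrite (negPf (monic_neq0 (monic_prod_XsubC _ _ _))).
move=> mu; have [ms|ms] := boolP (mu \in s); first exact: S0.
rewrite big1// => i /eqP il.
by rewrite -il sin in ms.
Qed.

Section Positivity.
Context {R : realType}.

(** For a primitive [f] of a nonnegative [df], the condition [f b <= f a] says that [df] has no mass
    on the interval; this yields its pointwise vanishing from the primitive alone. *)
Lemma derive_const_eq0 (f df : R -> R) (a b : R) :
  (forall v : R, is_derive v 1 f (df v)) -> (forall v, 0 <= df v) ->
  f b <= f a -> forall v, v \in `]a, b[%R -> df v = 0.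
Proof.
move=> fd df0 fba v vab.
have ab : a <= b by have := vab; rewrite in_itv/= => /andP[av /(lt_trans av)/ltW].
have fc : continuous f.
  move=> u; apply: differentiable_continuous; apply/derivable1_diffP.
  exact: ex_derive.
have mono : {in `[a, b]%R &, {homo f : x y / x <= y}}.
  apply: ger0_derive1_le_cc => [u _|u _|].
  - exact: ex_derive.
  - by rewrite derive1E derive_val.
  - exact: continuous_subspaceT.
have cst t : t \in `]a, b[%R -> f t = f a.
  rewrite in_itv/= => /andP[at_ tb]; apply/le_anti/andP; split.
    by apply: le_trans fba; apply: mono; rewrite ?in_itv/= ?(ltW at_) ?(ltW tb) ?ab ?lexx.
  by apply: mono; rewrite ?in_itv/= ?(ltW at_) ?(ltW tb) ?ab ?lexx.
(* [f] is nondecreasing with [f b <= f a], hence constant on [a, b]. *)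
have D0 : is_derive v 1 f 0.
  (* A constant function has a maximum at each interior point. *)
  apply: (@derive1_at_max _ f a b) => //.
  by move=> t tab; rewrite !cst.
by rewrite -(@derive_val _ _ _ _ _ _ _ (fd v)) (@derive_val _ _ _ _ _ _ _ D0).
Qed.

Lemma fro_norm_eq0 (p q : nat) (G : 'M[R[i]]_(p, q)) : fro_norm G ^+ 2 = 0 -> G = 0.
Proof.
move=> G0; apply/matrixP => i j; rewrite mxE.
have := cplx_fro_norm _ _ G; rewrite G0 rmorph0 => /esym/eqP.
rewrite psumr_eq0; last first.
  by move=> k _; apply: sumr_ge0 => l _; rewrite mul_conjC_ge0.
move=> /allP/(_ i); rewrite mem_index_enum /= => /(_ isT).
rewrite psumr_eq0; last by move=> l _; rewrite mul_conjC_ge0.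
move=> /allP/(_ j); rewrite mem_index_enum /= => /(_ isT).
by rewrite mul_conjC_eq0 => /eqP.
Qed.

Context {n nu ny : nat}.
Context (lam : 'rV[R[i]]_n) (Phi : 'I_n -> 'M[R[i]]_(ny, nu)) (w : R).
Hypothesis lam0 : forall i, complex.Re (lam 0 i) < 0.
Hypothesis w0 : 0 < w.
Let Q := Qcal_mx lam Phi w.

Lemma Qcal_hermsymmx : Q \is hermsymmx.
Proof.
apply/is_hermitianmxP; rewrite expr0 scale1r /Q /Qcal_mx tr_block_mx map_block_mx.
congr block_mx.
- apply/matrixP => i j; rewrite !mxE !a_wJ//.
  have -> : \tr (Phi i *m (Phi j)^t*) = (\tr (Phi j *m (Phi i)^t*))^*.
    rewrite -mxtrace_tr trmx_mul map_trmx trmxK.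
    rewrite /mxtrace rmorph_sum/=; apply: eq_bigr => k _.
    rewrite !mxE rmorph_sum/=; apply: eq_bigr => l _.
    by rewrite !mxE conjM conjCK mulrC.
  move: (a_w w (lam 0 i)) (a_w w (lam 0 j)) (\tr _) => x y z.
  rewrite !(conjM,conjD,conjN,conjV) !conjCK cplxJ.
  by rewrite (addrC x) (addrC (- lam 0 i)); ring.
- apply/matrixP => i j; rewrite !mxE.
  by rewrite (conjM 2%:R^-1) conjCK conjV rmorph_nat.
- by apply/matrixP => i j; rewrite !mxE (conjM 2%:R^-1) conjV rmorph_nat.
- by apply/matrixP => i j; rewrite !mxE eq_sym rmorphMn/= cplxJ.
Qed.

Lemma qform_integral (b : 'cV[R]_n) (E : 'M[R]_(ny, nu)) :
  complex.Re (qform Q (col_mx b (vec E))) = (2 * pi)^-1 *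
    \int[lebesgue_measure]_(v in `[- w, w])
      fro_norm (modal_error lam Phi b E ('i * cplx v)) ^+ 2.
Proof.
have [F PF FE] := modal_error_primitive lam Phi w lam0 b E.
have := integral_primitive _ _ _ w0 PF; rewrite FE => ->.
by rewrite cReM /= mul0r subr0 mulKf// gt_eqF// mulr_gt0 ?pi_gt0.
Qed.

Lemma qform_gt0 (x : 'cV[R]_(n + nu * ny)) :
  (forall b : 'I_n -> R[i],
    (forall mu p q, \sum_(i | lam 0 i == mu) b i * Phi i p q = 0) -> forall i, b i = 0) ->
  x != 0 -> 0 < complex.Re (qform Q x).
Proof.
move=> indep; rewrite ltNge; apply: contraNN => q0; apply/eqP; move: q0.
rewrite -[x]vsubmxK; set b := usubmx x.
set E : 'M[R]_(ny, nu) := (vec_mx (dsubmx x)^T)^T.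
have -> : dsubmx x = vec E by rewrite /vec /E trmxK vec_mxK trmxK.
clearbody b E.
have [F [F1 _ _ _] FE] := modal_error_primitive lam Phi w lam0 b E.
move=> q0.
(* A nonpositive energy means that the nondecreasing [Re F] does not grow over [[- w, w]]. *)
have FF : complex.Re (F w) <= complex.Re (F (- w)).
  rewrite -subr_le0 -cReN -cReD FE cReM /= mul0r subr0.
  by rewrite pmulr_rle0// mulr_gt0 ?pi_gt0.
have G0 v : v \in `](- w), w[%R -> modal_error lam Phi b E ('i * cplx v) = 0.
  move=> vw; apply: fro_norm_eq0.
  exact: (@derive_const_eq0 _ _ _ _ F1 (fun v => sqr_ge0 _) FF).
(* Infinitely many distinct sample points; the offset 2 keeps [w / k.+2] strictly below the endpoint
   [w]. *)
pose x_ (k : nat) : R[i] := 'i * cplx (w / k.+2%:R).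
have xw k : w / k.+2%:R \in `](- w), w[%R.
  rewrite in_itv/= ltr_pdivrMr// ltr_pMr// ltr1n andbT.
  by rewrite (@lt_trans _ _ 0)// ?oppr_lt0// divr_gt0.
have PF p q := @partial_fraction_eq0 _ n (fun i => lam 0 i)
  (fun i => cplx (b i 0) * Phi i p q) (cplx (E p q)) x_.
have {}PF p q : cplx (E p q) = 0 /\
    forall mu, \sum_(i | lam 0 i == mu) cplx (b i 0) * Phi i p q = 0.
  apply: PF.
  - move=> k l /(congr1 (@complex.Im R)); rewrite /x_ !cImM imagE /= !mul0r !add0r !mul1r.
    move=> /(mulfI _); rewrite gt_eqF// => /(_ isT)/invr_inj/eqP.
    by rewrite eqr_nat => /eqP[].
  - by move=> k i; rewrite -subr_eq0; apply: pole_neq0; exact: lam0.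
  - move=> k; have /matrixP/(_ p q) := G0 _ (xw k).
    rewrite !mxE summxE => /eqP; rewrite subr_eq0 => /eqP <-.
    by apply: eq_bigr => i _; rewrite [RHS]mxE mulrAC.
have b0 : b = 0.
  apply/colP => i; rewrite mxE; apply: (@complexI R).
  by apply: (indep (fun i => cplx (b i 0))) => mu p q; have [_ ->] := PF p q.
have E0 : E = 0.
  by apply/matrixP => p q; rewrite mxE; apply: (@complexI R); have [e _] := PF p q; exact: e.
by rewrite b0 E0 /vec !linear0 col_mx0.
Qed.
End Positivity.

(** * The quadratic objective *)

Section QuadraticObjective.
Context {R : realType} {m : nat} (Q : 'M[R[i]]_m).
Implicit Types x y z : 'cV[R]_m.
Local Notation bform := (bform Q).
Local Notation qform := (qform Q).

Lemma bformDl x y z : bform (x + y) z = bform x z + bform y z.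
Proof. by rewrite /bform /cplx_mx map_mxD linearD !mulmxDl mxE. Qed.

Lemma bformDr x y z : bform z (x + y) = bform z x + bform z y.
Proof. by rewrite /bform /cplx_mx map_mxD mulmxDr mxE. Qed.

Lemma bformZl (t : R) x z : bform (t *: x) z = cplx t * bform x z.
Proof. by rewrite /bform /cplx_mx map_mxZ linearZ/= -!scalemxAl mxE. Qed.

Lemma bformZr (t : R) x z : bform z (t *: x) = cplx t * bform z x.
Proof. by rewrite /bform /cplx_mx map_mxZ -scalemxAr mxE. Qed.

Lemma bformJ x y : Q \is hermsymmx -> (bform x y)^* = bform y x.
Proof.
move=> /is_hermitianmxP; rewrite expr0 scale1r => QE.
have cx u : map_mx Num.conj (cplx_mx u) = cplx_mx u :> 'cV[R[i]]_m.
  by apply/matrixP => i j; rewrite !mxE cplxJ.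
transitivity (map_mx Num.conj ((cplx_mx x)^T *m Q *m cplx_mx y)^T 0 0).
  by rewrite [RHS]mxE; congr (_^*); rewrite [RHS]mxE.
rewrite !trmx_mul trmxK !map_mxM -QE -map_trmx /= !cx.
by rewrite /bform mulmxA.
Qed.

Lemma qform_real x : Q \is hermsymmx -> qform x = cplx (complex.Re (qform x)).
Proof.
move=> Qh; apply: complex_eqP => //=.
have /(congr1 (@complex.Im R)) := bformJ x x Qh.
rewrite cImJ -[bform _ _]/(qform x); lra.
Qed.

Lemma quad_objE (c : 'cV[R[i]]_m) x z : c = - 2%:R *: (Q *m cplx_mx z) ->
  quad_obj Q c x = qform x - 2 * bform x z.
Proof.
move=> ->; rewrite /quad_obj mxE; congr (_ + _).
rewrite linearZ/= -scalemxAl mxE mulNr; congr (- (_ * _)).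
transitivity (((Q *m cplx_mx z)^T *m cplx_mx x)^T 0 0); first by rewrite [RHS]mxE.
by rewrite trmx_mul trmxK mulmxA.
Qed.

(** The linear part cancels and the convexity gap is exactly [t (1 - t)] times the quadratic form at
    [x - y]. That form is real, so the gap is positive for the order of [R[i]]. *)
Lemma quad_obj_strictly_convex (c : 'cV[R[i]]_m) : Q \is hermsymmx ->
  (forall x, x != 0 -> 0 < complex.Re (qform x)) ->
  strictly_convex (quad_obj Q c).
Proof.
move=> Qh Qpos x y t xy /andP[t0 t1].
have qE u : quad_obj Q c u = bform u u + (c^T *m cplx_mx u) 0 0 by rewrite /quad_obj mxE.
have d0 : 0 < cplx (t * (1 - t)) * qform (x - y).
  rewrite qform_real// -(rmorphM (@cplx R)) ltcE/= eqxx/=.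
  by rewrite mulr_gt0 ?Qpos ?subr_eq0// mulr_gt0// subr_gt0.
rewrite -subr_gt0; apply: lt_le_trans d0 _.
rewrite le_eqVlt; apply/orP; left; apply/eqP.
rewrite !qE -[qform _]/(bform _ _) -(scaleN1r y).
rewrite !(bformDl, bformDr, bformZl, bformZr).
have -> : cplx_mx (t *: x + (1 - t) *: y) = cplx t *: cplx_mx x + cplx (1 - t) *: cplx_mx y.
  by rewrite /cplx_mx map_mxD !map_mxZ.
rewrite mulmxDr -!scalemxAr [X in _ = _ - (_ + X)]mxE ![X in _ = _ - (_ + (X + _))]mxE.
rewrite ![X in _ = _ - (_ + (_ + X))]mxE.
rewrite !(rmorphM (@cplx R)) !(rmorphB (@cplx R)) (rmorphN (@cplx R)) !(rmorph1 (@cplx R)).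
ring.
Qed.
End QuadraticObjective.

Lemma sum_reindex_image (V : nmodType) (I J : finType) (h : J -> I) (P : pred I) (G : I -> V) :
  injective h -> (forall i, P i <-> exists k, h k = i) ->
  \sum_(i | P i) G i = \sum_k G (h k).
Proof.
move=> hI hP; transitivity (\sum_(i in h @: [set: J]) G i).
  apply: eq_bigl => i; apply/idP/imsetP => [/hP[k <-]|[k _ ->]].
    by exists k; rewrite ?inE.
  by apply/hP; exists k.
by rewrite big_imset/=; [apply: eq_bigl => k; rewrite in_setT | move=> ? ? _ _ /hI].
Qed.

(** * Linear term and realness of the cross term *)

Section Truncation.
Context {R : realType} {n nu ny nc : nat}.
Context (lam : 'rV[R[i]]_n) (Phi : 'I_n -> 'M[R[i]]_(ny, nu)) (w : R).
Context (ip jp : 'I_nc -> 'I_n).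
Hypothesis lam0 : forall i, complex.Re (lam 0 i) < 0.
Let Q := Qcal_mx lam Phi w.

(** This identifies the centre [(0, vec D)] for completing the square: [- 2] times the block [U / 2]
    restores the coefficient [- 2 / pi] of the linear term. *)
Lemma c_vecE (d : 'cV[R]_(nu * ny)) :
  c_vec lam Phi w d = - 2%:R *: (Q *m cplx_mx (col_mx 0 d)).
Proof.
have pi0 : cplx pi != 0 :> R[i] by rewrite fmorph_eq0 gt_eqF ?pi_gt0.
rewrite /Q /Qcal_mx /cplx_mx map_col_mx map_mx0 mul_block_col !mulmx0 !add0r.
rewrite /c_vec [LHS]scale_col_mx [RHS]scale_col_mx.
apply: (f_equal2 (fun x y => col_mx x y)); apply/colP => i.
  rewrite -scalemxAl !mxE.
  set S := \sum_j _; set S' := \sum_j _.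
  have -> : S' = (2%:R / cplx pi * a_w w (lam 0 i)) * S.
    by rewrite /S mulr_sumr; apply: eq_bigr => j _; rewrite !mxE -!mulrA.
  by move: S (a_w _ _) (cplx pi) pi0 => S a P P0; field.
rewrite mul_scalar_mx !mxE (rmorphM (@cplx R)) (fmorphV (@cplx R))/=.
by move: (cplx pi) pi0 => P P0; field.
Qed.

(** The sign of [Im lam_i] splits the indices into real poles, whose terms conjugation fixes, and
    the images of [ip] and [jp], whose sums it exchanges. *)
Lemma sum_conjugate_pairs (g : 'I_n -> R[i]) : conjugate_pairs lam Phi ip jp ->
  (forall i, complex.Im (lam 0 i) = 0 -> (g i)^* = g i) ->
  (forall k, g (jp k) = (g (ip k))^*) ->
  (\sum_i g i)^* = \sum_i g i.
Proof.
move=> [ipI jpI ipP jpP _] greal gpair.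
have split : \sum_i g i = \sum_(i | complex.Im (lam 0 i) == 0) g i +
    (\sum_k g (ip k) + \sum_k g (jp k)).
  rewrite (bigID (fun i => complex.Im (lam 0 i) == 0))/=; congr (_ + _).
  rewrite (bigID (fun i => 0 < complex.Im (lam 0 i)))/=; congr (_ + _).
  - rewrite -(sum_reindex_image _ _ _ ip (fun i => 0 < complex.Im (lam 0 i)))//.
    by apply: eq_bigl => i; case: (ltgtP (complex.Im (lam 0 i)) 0).
  - rewrite -(sum_reindex_image _ _ _ jp (fun i => complex.Im (lam 0 i) < 0))//.
    by apply: eq_bigl => i; case: (ltgtP (complex.Im (lam 0 i)) 0).
rewrite split !conjD; congr (_ + _).
  rewrite rmorph_sum; apply: eq_bigr => i /eqP; exact: greal.
rewrite addrC; congr (_ + _); rewrite rmorph_sum/=; apply: eq_bigr => k _.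
  by rewrite gpair conjCK.
by rewrite gpair.
Qed.

Lemma pair_mxP (b : 'cV[R]_n) :
  pair_mx R ip jp *m b = 0 -> forall k, b (ip k) 0 = b (jp k) 0.
Proof.
move=> Mb k; have /colP/(_ k) := Mb; rewrite !mxE.
under eq_bigr do rewrite mxE mulrBl !mulr_natl !mulrb.
by rewrite sumrB -!big_mkcond/= !big_pred1_eq => /eqP; rewrite subr_eq0 => /eqP.
Qed.

(** The cross term is a real part from the feedthrough block plus a sum over modes of
    [b_i a_w (lam_i) vec (Phi_i)^T d] up to a real factor. Equal weights on each pair make the terms
    of a pair conjugate. *)
Lemma bform_real (b : 'cV[R]_n) (e d : 'cV[R]_(nu * ny)) :
  conjugate_pairs lam Phi ip jp -> (forall k, b (ip k) 0 = b (jp k) 0) ->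
  (bform Q (col_mx b e) (col_mx 0 d))^* = bform Q (col_mx b e) (col_mx 0 d).
Proof.
move=> hp bp.
have -> : bform Q (col_mx b e) (col_mx 0 d) =
    \sum_i cplx (b i 0) * (2%:R^-1 * (2%:R / cplx pi * a_w w (lam 0 i)
      * \sum_k vec (Phi i) k 0 * cplx (d k 0)))
    + \sum_k cplx (e k 0) * (cplx (w / pi) * cplx (d k 0)).
  rewrite /bform /Q /Qcal_mx /cplx_mx !map_col_mx map_mx0 tr_col_mx -mulmxA.
  rewrite mul_block_col !mulmx0 !add0r mul_row_col mxE; congr (_ + _); rewrite mxE.
    apply: eq_bigr => i _; rewrite -scalemxAl !mxE; congr (_ * (_ * _)).
    by rewrite mulr_sumr; apply: eq_bigr => k _; rewrite !mxE -!mulrA.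
  by apply: eq_bigr => k _; rewrite mul_scalar_mx !mxE.
rewrite conjD; congr (_ + _); last first.
  rewrite rmorph_sum; apply: eq_bigr => k _ /=.
  by rewrite -!(rmorphM (@cplx R)) cplxJ.
have [_ _ _ _ [lamp Phip Phir]] := hp.
have SJ i G : G = map_mx Num.conj (Phi i) ->
  \sum_k vec G k 0 * cplx (d k 0) = (\sum_k vec (Phi i) k 0 * cplx (d k 0))^*.
  move=> ->; rewrite rmorph_sum; apply: eq_bigr => k _ /=.
  rewrite conjM cplxJ; congr (_ * _).
  by rewrite /vec map_trmx -map_mxvec map_trmx [LHS]mxE.
have c2 : (2 : R[i])^* = 2 by exact: rmorph_nat.
apply: sum_conjugate_pairs => // [i li|k].
  have aJ : (a_w w (lam 0 i))^* = a_w w (lam 0 i).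
    by rewrite -a_wJ//; congr (a_w w _); apply: complex_eqP; rewrite ?cReJ ?cImJ// li oppr0.
  have := SJ i (Phi i) (esym (Phir i li)).
  set S := \sum_k _ => SE.
  rewrite (conjM (cplx _)) (conjM 2%:R^-1) (conjM _ S) (conjM _ (a_w _ _)).
  by rewrite -SE aJ conjM cplxJ cplxJinv conjV c2.
have := SJ (ip k) _ (Phip k).
rewrite lamp a_wJ// -bp => ->; set S := \sum_k _.
move: (a_w _ _) => a.
rewrite (conjM (cplx _)) (conjM 2%:R^-1) (conjM _ S) (conjM _ a).
by rewrite conjM cplxJ cplxJinv conjV c2.
Qed.
End Truncation.

(** * Equivalence of the two minimisation problems *)

Theorem theorem2 (R : realType) (n nu ny nc r : nat)
    (A : 'M[R]_n) (B : 'M[R]_(n, nu)) (C : 'M[R]_(ny, n)) (D : 'M[R]_(ny, nu))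
    (X : 'M[R[i]]_n) (lam : 'rV[R[i]]_n) (ip jp : 'I_nc -> 'I_n) (w : R)
    (Phi := residue X B C) (M := pair_mx R ip jp)
    (Q := Qcal_mx lam Phi w) (c := c_vec lam Phi w (vec D))
    (hstable : stable A)
    (hX : X \in unitmx)
    (hAX : cplx_mx A *m X = X *m diag_mx lam)
    (hpairs : conjugate_pairs lam Phi ip jp)
    (hr : (0 < r < n)%N)
    (hw : 0 < w) :
  [/\ Q \is hermsymmx,
      controllable A B -> observable A C -> strictly_convex (quad_obj Q c) &
      forall (alpha : 'cV[R]_n) (Da : 'M[R]_(ny, nu)),
        is_minimizer (fun p => feasible r M p.1)
          (fun p => h2w_norm w (fun s =>
             transfer A B C D s - truncation lam Phi p.1 p.2 s))
          (alpha, Da)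
        <->
        is_minimizer (fun p => feasible r M p.1)
          (fun p => quad_obj Q c (x_vec p.1 p.2))
          (alpha, vec Da)].
Proof.
have lam0 i : complex.Re (lam 0 i) < 0 by exact: (stable_pole A X).
have Qh : Q \is hermsymmx by exact: Qcal_hermsymmx.
split; [exact: Qh | move=> ctr obs | move=> alpha Da].
  apply: (quad_obj_strictly_convex _ _ Qh) => x x0.
  apply: (qform_gt0 _ _ _ lam0 hw _ _ x0) => b bPhi i.
  exact: (residue_combination_eq0 A B C X lam hX hAX b ctr obs bPhi).
pose z : 'cV[R]_(n + nu * ny) := col_mx 0 (vec D).
(* The squared error norm, as a quadratic form centred at [z]. *)
pose e (p : 'cV[R]_n * 'M[R]_(ny, nu)) := complex.Re (qform Q (x_vec p.1 (vec p.2) - z)).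
have xzE p : x_vec p.1 (vec p.2) - z = col_mx (const_mx 1 - p.1) (vec (p.2 - D)).
  rewrite /x_vec /z opp_col_mx add_col_mx subr0; congr col_mx.
  by rewrite /vec !linearB.
have h2wE p : h2w_norm w (fun s =>
    transfer A B C D s - truncation lam Phi p.1 p.2 s) = Num.sqrt (e p).
  rewrite /h2w_norm /e xzE (qform_integral _ _ _ lam0 hw); congr (Num.sqrt (_ * _)).
  apply: eq_Rintegral => v _; congr (fro_norm _ ^+ 2).
  rewrite (transferE A B C X lam hX hAX); last by move=> i; exact: pole_neq0.
  rewrite /truncation /modal_error opprD addrACA addrC; congr (_ + _).
    rewrite -sumrB; apply: eq_bigr => i _.
    rewrite -scalerBl; congr (_ *: _).
    by rewrite !mxE (rmorphB (@cplx R)) (rmorph1 (@cplx R)) mulrBl mul1r.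
  by rewrite /cplx_mx map_mxB opprB.
have e_ge0 p : 0 <= e p.
  rewrite /e xzE (qform_integral _ _ _ lam0 hw); apply: mulr_ge0.
    by rewrite invr_ge0 mulr_ge0 ?pi_ge0.
  by apply: Rintegral_ge0 => v _; exact: sqr_ge0.
have quadE p : feasible r M p.1 ->
    quad_obj Q c (x_vec p.1 (vec p.2)) = cplx (e p) - qform Q z.
  move=> [_ _ Mp]; rewrite (quad_objE _ _ _ z); last exact: c_vecE.
  rewrite /e -(qform_real _ _ Qh); set x := x_vec _ _.
  (* Hermitian symmetry only makes the two cross terms conjugate; they coincide because feasibility
     makes them real. *)
  have bzx : bform Q z x = bform Q x z.
    rewrite -(bformJ _ _ _ Qh); apply: bform_real hpairs _ => [//|k].
    by rewrite !mxE (pair_mxP _ _ _ Mp).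
  rewrite -[qform Q x]/(bform Q x x) -[qform Q (x - z)]/(bform Q (x - z) (x - z)).
  rewrite -[qform Q z]/(bform Q z z) -(scaleN1r z).
  rewrite !(bformDl, bformDr, bformZl, bformZr) bzx (rmorphN (@cplx R)) (rmorph1 (@cplx R)).
  move: (bform Q x x) (bform Q x z) (bform Q z z) => a b d; ring.
(* Both objectives are shifted by the same constant, so comparison in [R[i]] reduces to comparison
   of real energies, then of their square roots. *)
have le_obj p q : feasible r M p.1 -> feasible r M q.1 ->
    (quad_obj Q c (x_vec p.1 (vec p.2)) <= quad_obj Q c (x_vec q.1 (vec q.2))) =
    (Num.sqrt (e p) <= Num.sqrt (e q)).
  move=> Fp Fq; rewrite (quadE p Fp) (quadE q Fq) lerD2r ler_sqrt; last exact: e_ge0.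
  exact: lecR.
split=> -[Fa mina]; (split; [exact: Fa | move=> [b E] Fb]).
  (* [vec] is onto: every competitor of the quadratic problem comes from a matrix. *)
  pose E' : 'M[R]_(ny, nu) := (vec_mx E^T)^T.
  have -> : E = vec E' by rewrite /vec /E' trmxK vec_mxK trmxK.
  by have := mina (b, E') Fb; rewrite !h2wE -(le_obj (alpha, Da) (b, E') Fa Fb).
rewrite !h2wE -(le_obj (alpha, Da) (b, E) Fa Fb).
exact: (mina (b, vec E) Fb).
Qed.
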